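(* Let $\mathcal{S}=\{p_1,\dots,p_{s-1},p\}\subset\mathbb{R}^n$, $\mathcal{S}'$, $x$, $d$, $\ell$, $\ell^+$, $x'$, $p'$, $F_j$, $\alpha_j$, $\alpha_f$ be as in the context, and write uniquely $x'=\sum_{j=1}^{s-1}\pi_jp_j$ with $\sum_{j=1}^{s-1}\pi_j=1$, and $p'=\sum_{j=1}^{s-1}\omega_jp_j$ with $\sum_{j=1}^{s-1}\omega_j=1$. A facet among $F_1,\dots,F_{s-1}$ first intersected by $\ell^+$, and the value $\alpha_f$ at which this intersection occurs, are found as follows. Case 1. If there is $k\in\{1,\dots,s-1\}$ with $\pi_k=\omega_k=0$, then $F_k$ (the facet opposed to $p_k$) is a facet first intersected by $\ell^+$, and $\alpha_f=\alpha_k=0$. Case 2. Suppose there is no $k\in\{1,\dots,s-1\}$ with $\pi_k=\omega_k=0$. Let $k_1$ be such that $$\frac{\pi_{k_1}}{\omega_{k_1}}=\min_{j=1,\dots,s-1}\left\{\frac{\pi_j}{\omega_j}:\ \pi_j\ge 0,\ \omega_j>0\right\},$$ and let $\alpha_{k_1}$ be given by formula (A) of the context with $j=k_1$. Let $\mathcal{J}=\{j:\ \pi_j\le 0,\ \omega_j<0\}$. If $\mathcal{J}\neq\emptyset$, let $k_2$ be such that $$\frac{\pi_{k_2}}{\omega_{k_2}}=\max_{j=1,\dots,s-1}\left\{\frac{\pi_j}{\omega_j}:\ \pi_j\le 0,\ \omega_j<0\right\},$$ and let $\alpha_{k_2}$ be given by formula (A) with $j=k_2$; if $\mathcal{J}=\emptyset$,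 put $\alpha_{k_2}=-\infty$. Then for $$k=\arg\min_{j=k_1,k_2}\{\alpha_j:\ \alpha_j\ge 0\}$$ (any minimizer), $F_k$ is a facet first intersected by $\ell^+$, and $\alpha_f=\alpha_k$.
   Context: Setting. $\mathcal{S}=\{p_1,\dots,p_{s-1},p\}\subset\mathbb{R}^n$ ($s\ge 2$) is an affinely independent set of $s$ points and $\mathcal{S}'=\mathcal{S}\setminus\{p\}=\{p_1,\dots,p_{s-1}\}$. For a finite set $\mathcal{T}$, $\operatorname{aff}(\mathcal{T})$ is its affine hull, $\operatorname{conv}(\mathcal{T})$ its convex hull, and $\operatorname{Sub}(\mathcal{T})$ the linear subspace parallel to $\operatorname{aff}(\mathcal{T})$ (spanned by differences of points of $\mathcal{T}$). The point $x$ satisfies $x\in\operatorname{conv}(\mathcal{S})$. The direction $d\in\operatorname{Sub}(\mathcal{S})$ is orthogonal to $\operatorname{Sub}(\mathcal{S}')$ and points towards $p$, normalized by $(p-p_{s-1})^Td=1$. Put $\ell=\{x+\alpha d:\alpha\in\mathbb{R}\}$ and $\ell^+=\{x+\alpha d:\alpha\ge 0\}$; the line $\ell$ passes through the intersection of the bisectors of the facets of $\operatorname{conv}(\mathcal{S})$, i.e. the point of $\operatorname{aff}(\mathcal{S})$ equidistant from all points of $\mathcal{S}$. $x'$ and $p'$ are the orthogonal projections of $x$ and $p$ onto $\operatorname{aff}(\mathcal{S}')$. For $j=1,\dots,s-1$, $F_j=\operatorname{conv}(\mathcal{S}\setminus\{p_j\})$ is the facet of $\operatorname{conv}(\mathcal{S})$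 opposed to $p_j$, and $\alpha_j$ denotes the value of $\alpha$ at which the line $\ell$ (with points $x+\alpha d$) intersects $F_j$. The number $\alpha_f=\min_{j=1,\dots,s-1}\{\alpha_j:\alpha_j\ge 0\}$ is the smallest $\alpha\ge0$ such that $x+\alpha d\in F_1\cup\dots\cup F_{s-1}$. A facet $F_k$ with $k\in\{1,\dots,s-1\}$ is ''first intersected by $\ell^+$'' if $x+\alpha_f d\in F_k$. (If $\ell$ meets $F_k$ in more than one point, $\alpha_k$ means the smallest nonnegative such $\alpha$.) Formula (A): given $j\in\{1,\dots,s-1\}$ and a basis $\{w_1,\dots,w_{n-s+2}\}$ of the orthogonal complement in $\mathbb{R}^n$ of $\operatorname{Sub}((\mathcal{S}'\setminus\{p_j\})\cup\{p\})$, $$\alpha_j=\frac{(p-x)^Tw_i}{d^Tw_i}\quad\text{for any } i\in\{1,\dots,n-s+2\}\text{ with } d^Tw_i\neq 0.$$ *)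

(* Defs.v *)
From HB Require Import structures.
From mathcomp Require Import all_boot all_order all_algebra.
From mathcomp Require Import classical_sets reals constructive_ereal.

Set Implicit Arguments.
Unset Strict Implicit.
Unset Printing Implicit Defensive.

Import Order.TTheory GRing.Theory Num.Theory.
Local Open Scope classical_set_scope.
Local Open Scope ring_scope.

Section FiniteSets.
Variables (R : realType) (n : nat).
Local Notation V := 'cV[R]_n.

Definition dot (u v : V) : R := (u^T *m v) 0 0.

Definition enorm (u : V) : R := Num.sqrt (dot u u).

(* A finite set of points is represented by a sequence; none of the notions
   below depends on the order of its entries. *)

Definition setminus (T : seq V) (y : V) : seq V := [seq z <- T | z != y].

(* A free family contains neither 0 nor repetitions, so the entries of an
   affinely independent sequence are pairwise distinct. *)
Definition aff_indep (T : seq V) : bool :=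
  free [seq y - head 0 T | y <- behead T].

Definition aff (T : seq V) : set V :=
  [set y | exists2 c : V -> R,
     \sum_(z <- T) c z = 1 & y = \sum_(z <- T) c z *: z].

Definition conv (T : seq V) : set V :=
  [set y | exists c : V -> R,
     [/\ forall z, z \in T -> 0 <= c z,
         \sum_(z <- T) c z = 1 & y = \sum_(z <- T) c z *: z]].

Definition SubSp (T : seq V) : {vspace V} :=
  <<[seq y - z | y <- T, z <- T]>>%VS.

Definition orth (v : V) (U : {vspace V}) : Prop :=
  forall u, u \in U -> dot v u = 0.

Definition orth_proj (T : seq V) (y y' : V) : Prop :=
  aff T y' /\ orth (y - y') (SubSp T).

Definition orthocompl_basis (U : {vspace V}) (w : seq V) : Prop :=
  free w /\ forall v, v \in <<w>>%VS <-> orth v U.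

Definition is_min (A : set R) (a : R) : Prop := A a /\ lbound A a.

End FiniteSets.

(* pts lists the s points of S: q 0, ..., q m (that is, p_1, ..., p_{s-1})
   followed by p; pts' lists S', that is S without p. Thus s = m.+2, the point
   p_{s-1} is q ord_max, and n - s + 2 = n - m. *)
Section Facets.
Variables (R : realType) (n m : nat).
Local Notation V := 'cV[R]_n.
Variables (q : 'I_m.+1 -> V) (p : V).

Definition pts' : seq V := codom q.

Definition pts : seq V := rcons pts' p.

Definition facet (j : 'I_m.+1) : set V := conv (setminus pts (q j)).

Variables (x d : V).

Definition hits (j : 'I_m.+1) : set R := [set a | facet j (x + a *: d)].

(* alpha_j is only partially defined, hence a relation: a is the only
   parameter at which the line meets facet j or, if there are several, the
   smallest nonnegative one. *)
Definition is_alpha (j : 'I_m.+1) (a : R) : Prop :=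
  hits j = [set a] \/
  (exists b c, [/\ hits j b, hits j c & b <> c]) /\
  is_min [set b | hits j b /\ 0 <= b] a.

Definition is_alphaf (a : R) : Prop :=
  is_min [set b | 0 <= b /\ exists j, is_alpha j b] a.

Definition first_intersected (k : 'I_m.+1) : Prop :=
  exists2 a, is_alphaf a & facet k (x + a *: d).

Definition SubFacet (j : 'I_m.+1) : {vspace V} :=
  SubSp (rcons (setminus pts' (q j)) p).

(* w j is the basis used to evaluate alpha_j; a is the value obtained from some
   index i for which the denominator does not vanish. *)
Definition formulaA (w : 'I_m.+1 -> (n - m).-tuple V) (j : 'I_m.+1) (a : R) :
    Prop :=
  exists2 i, dot d (tnth (w j) i) != 0 &
    a = dot (p - x) (tnth (w j) i) / dot d (tnth (w j) i).

Variables (pi omega : 'I_m.+1 -> R).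

Definition is_k1 (k : 'I_m.+1) : Prop :=
  [/\ 0 <= pi k, 0 < omega k &
      forall j, 0 <= pi j -> 0 < omega j -> pi k / omega k <= pi j / omega j].

Definition inJ (j : 'I_m.+1) : Prop := pi j <= 0 /\ omega j < 0.

Definition is_k2 (k : 'I_m.+1) : Prop :=
  inJ k /\ forall j, inJ j -> pi j / omega j <= pi k / omega k.

(* If J is empty then k2 is an unused dummy index carrying the value -oo. *)
Definition case2_data (w : 'I_m.+1 -> (n - m).-tuple V)
    (k1 : 'I_m.+1) (a1 : R) (k2 : 'I_m.+1) (a2 : \bar R) : Prop :=
  [/\ is_k1 k1, formulaA w k1 a1,
      (exists j, inJ j) ->
        is_k2 k2 /\ (exists2 r, formulaA w k2 r & a2 = r%:E) &
      ~ (exists j, inJ j) -> a2 = -oo%E].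

End Facets.

Definition argmin_ge0 (R : realType) (I : eqType) (c : seq (I * \bar R))
    (k : I) (a : \bar R) : Prop :=
  [/\ (k, a) \in c, (0 <= a)%E &
      forall k' a', (k', a') \in c -> (0 <= a')%E -> (a <= a')%E].

(* Main.v *)
Require Import Defs.
From HB Require Import structures.
From mathcomp Require Import all_boot all_order all_algebra.
From mathcomp Require Import classical_sets reals constructive_ereal.
From mathcomp Require Import boolp ring.

Set Implicit Arguments.
Unset Strict Implicit.
Unset Printing Implicit Defensive.

Import Order.TTheory GRing.Theory Num.Theory.
Local Open Scope ring_scope.

(* In barycentric coordinates x = sum_j c_j p_j + mu p, and d = ga (p - p') with
   ga > 0, so x + a d has coordinates pi_j - t omega_j on p_j and t on p, where
   t = mu + a ga. Hence the line is in conv S exactly for 0 <= t and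
   t omega_j <= pi_j for all j, and is in F_j if moreover t omega_j = pi_j.
   These bounds form an interval containing mu (where a = 0); without degenerate
   facets its upper end is reached on F_{k1} and, if J is nonempty, its lower end
   on F_{k2}; no F_j is met strictly in between. Thus
   alpha_{k1} >= 0 >= alpha_{k2}. *)

(** * The dot product and orthogonality to a subspace *)

Section DotProduct.
Variables (R : realType) (n : nat).
Implicit Types (u v z : 'cV[R]_n) (U : {vspace 'cV[R]_n}) (X : seq 'cV[R]_n).

Lemma dotC u v : dot u v = dot v u.
Proof.
by rewrite /dot !mxE; apply: eq_bigr => i _; rewrite !mxE mulrC.
Qed.

Lemma dotDl u v z : dot (u + v) z = dot u z + dot v z.
Proof. by rewrite /dot linearD /= mulmxDl mxE. Qed.

Lemma dotZl a u z : dot (a *: u) z = a * dot u z.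
Proof. by rewrite /dot linearZ /= -scalemxAl mxE. Qed.

Lemma dotBl u v z : dot (u - v) z = dot u z - dot v z.
Proof. by rewrite -scaleN1r dotDl dotZl mulN1r. Qed.

Lemma dotDr u v z : dot z (u + v) = dot z u + dot z v.
Proof. by rewrite !(dotC z) dotDl. Qed.

Lemma dotZr a u z : dot z (a *: u) = a * dot z u.
Proof. by rewrite !(dotC z) dotZl. Qed.

Lemma dot0l z : dot 0 z = 0.
Proof. by rewrite -(scale0r z) dotZl mul0r. Qed.

Lemma dot_suml (I : finType) (F : I -> 'cV[R]_n) z :
  dot (\sum_i F i) z = \sum_i dot (F i) z.
Proof.
apply: (big_morph (fun y => dot y z)); first by move=> u v; rewrite dotDl.
exact: dot0l.
Qed.

Lemma dot_ge0 u : 0 <= dot u u.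
Proof.
by rewrite /dot mxE; apply: sumr_ge0 => i _; rewrite !mxE -expr2 sqr_ge0.
Qed.

Lemma dot_eq0 u : dot u u = 0 -> u = 0.
Proof.
rewrite /dot mxE => /psumr_eq0P u0; apply/colP => i.
have /eqP : u^T 0 i * u i 0 = 0.
  by apply: u0 => // j _; rewrite !mxE -expr2 sqr_ge0.
by rewrite !mxE mulf_eq0 orbb => /eqP.
Qed.

Lemma orthD u v U : orth u U -> orth v U -> orth (u + v) U.
Proof. by move=> uU vU z zU; rewrite dotDl uU // vU // addr0. Qed.

Lemma orthZ a u U : orth u U -> orth (a *: u) U.
Proof. by move=> uU z zU; rewrite dotZl uU // mulr0. Qed.

Lemma orthB u v U : orth u U -> orth v U -> orth (u - v) U.
Proof.
by move=> uU vU; rewrite -scaleN1r; apply: orthD => //; apply: orthZ.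
Qed.

Lemma orth_mem_eq0 u U : u \in U -> orth u U -> u = 0.
Proof. by move=> uU /(_ _ uU) /dot_eq0. Qed.

Lemma dot_span_eq0 u v X :
  (forall z, z \in X -> dot u z = 0) -> v \in <<X>>%VS -> dot u v = 0.
Proof.
move=> uX /(@coord_span _ _ _ (in_tuple X)) ->.
rewrite dotC dot_suml big1 // => i _.
by rewrite dotZl dotC uX ?mulr0 //= mem_nth.
Qed.

(* Gram-Schmidt; when the residual of y vanishes, the quotient is 0/0 = 0. *)
Lemma orth_residual X v : exists2 u, u \in <<X>>%VS & orth (v - u) <<X>>%VS.
Proof.
elim: X v => [|y X IH] v.
  exists 0; first exact: mem0v.
  by move=> z; rewrite span_nil memv0 => /eqP ->; rewrite dotC dot0l.
have [b bX yb] := IH y; have [a aX va] := IH v.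
set r := y - b in yb; pose c := dot v r / dot r r.
have sX : (<<X>> <= <<y :: X>>)%VS by rewrite span_cons addvSr.
have yS : y \in <<y :: X>>%VS by apply: memv_span; rewrite inE eqxx.
have rS : r \in <<y :: X>>%VS by rewrite memvB // (subvP sX).
exists (a + c *: r); first by rewrite memvD ?memvZ // (subvP sX).
rewrite opprD addrA => z.
have vX : orth (v - a - c *: r) <<X>>%VS by apply: orthB => //; apply: orthZ.
apply: dot_span_eq0 => {}z; rewrite inE => /orP[/eqP ->|zX]; last first.
  by apply: vX; apply: memv_span.
rewrite -(subrK b y) dotDr (vX b bX) addr0 -/r !dotBl dotZl.
rewrite (dotC a) (yb a aX) subr0 /c.
have [/dot_eq0 r0|r0] := eqVneq (dot r r) 0; last by rewrite divfK // subrr.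
by rewrite r0 [dot v 0]dotC !dot0l mulr0 subrr.
Qed.

End DotProduct.

(** * Direction spaces and affine independence *)

Section AffineFamilies.
Variables (R : realType) (n : nat).
Implicit Types (T : seq 'cV[R]_n) (U : {vspace 'cV[R]_n}).

Lemma SubSp_subv T U :
  (forall y z, y \in T -> z \in T -> y - z \in U) -> (SubSp T <= U)%VS.
Proof.
move=> TU; apply/span_subvP => _ /allpairsP[[y z] /= [yT zT ->]].
exact: TU.
Qed.

Lemma mem_SubSp T y z : y \in T -> z \in T -> y - z \in SubSp T.
Proof. by move=> yT zT; apply/memv_span/allpairsP; exists (y, z). Qed.

Lemma affine_comb_sub (I : finType) (f : I -> 'cV[R]_n) (c : I -> R) y U :
  \sum_i c i = 1 -> (forall i, f i - y \in U) -> \sum_i c i *: f i - y \in U.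
Proof.
move=> c1 fU; rewrite -[y in _ - y]scale1r -c1 scaler_suml -sumrB.
by apply: memv_suml => i _; rewrite -scalerBr memvZ.
Qed.

(** The coefficient of the head is minus the sum of the others, so the relation is one between the
    differences that [aff_indep] declares free. *)
Lemma aff_indep_coef0 T (c : nat -> R) : aff_indep T ->
  \sum_(i < size T) c i = 0 -> \sum_(i < size T) c i *: nth 0 T i = 0 ->
  forall i, (i < size T)%N -> c i = 0.
Proof.
case: T => [//|y0 T]; rewrite /aff_indep /=.
set X := map _ _ => freeX; rewrite !big_ord_recl /=.
move=> /eqP; rewrite addr_eq0 => /eqP c0E.
rewrite c0E scaleNr scaler_suml addrC -sumrB => X0.
have sX : size X = size T by rewrite size_map.
have cS i : (i < size T)%N -> c i.+1 = 0.
  move=> iT; have iX : (i < size X)%N by rewrite sX.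
  have /(@freeP _ _ _ (in_tuple X)) /(_ (fun j => c j.+1)) H := freeX.
  apply: (H _ (Ordinal iX)).
  change (\sum_(j < size X) c j.+1 *: X`_j = 0).
  rewrite -[RHS]X0 sX; apply: eq_bigr => j _.
  by rewrite (nth_map 0) // scalerBr.
case=> [_|i]; last by rewrite ltnS => /cS.
by rewrite c0E big1 ?oppr0 // => i _; rewrite cS.
Qed.

End AffineFamilies.

(** * Barycentric coordinates in the simplex *)

Section Simplex.
Variables (R : realType) (n m : nat).
Variables (q : 'I_m.+1 -> 'cV[R]_n) (p : 'cV[R]_n).
Hypothesis indepS : aff_indep (pts q p).

Lemma mem_pts' j : q j \in pts' q.
Proof. exact: codom_f. Qed.

Lemma sum_pts (M : nmodType) (F : 'cV[R]_n -> M) (P : pred 'cV[R]_n) :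
  \sum_(z <- pts q p | P z) F z =
  \sum_(j | P (q j)) F (q j) + (if P p then F p else 0).
Proof.
rewrite /pts -cats1 big_cat /pts' big_image_cond /=; congr (_ + _).
by rewrite big_cons big_nil addr0.
Qed.

Lemma bary_eq0 (c : 'I_m.+1 -> R) e :
  \sum_j c j + e = 0 -> \sum_j c j *: q j + e *: p = 0 ->
  (forall j, c j = 0) /\ e = 0.
Proof.
(* [f] lists the coefficients in the order of [pts]: positions up to [m] carry [c], the last
   position [m.+1] carries [e]. *)
move=> s0 v0; pose f i := if (i < m.+1)%N then c (inord i) else e.
have sz : size (pts q p) = m.+2 by rewrite size_rcons size_codom card_ord.
have sz' : size (pts' q) = m.+1 by rewrite size_codom card_ord.
have fq (j : 'I_m.+1) : f j = c j by rewrite /f ltn_ord inord_val.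
have fp : f m.+1 = e by rewrite /f ltnn.
have f0 i : (i < m.+2)%N -> f i = 0.
  rewrite -sz; apply: (aff_indep_coef0 indepS).
    rewrite sz big_ord_recr /= fp -[RHS]s0; congr (_ + _).
    by apply: eq_bigr => j _; rewrite fq.
  rewrite sz big_ord_recr /= fp -[RHS]v0; congr (_ + _ *: _).
    apply: eq_bigr => j _; rewrite fq nth_rcons sz' ltn_ord.
    by rewrite /pts' codomE (nth_map j) ?size_enum_ord // nth_ord_enum.
  by rewrite nth_rcons sz' ltnn eqxx.
split=> [j|]; first by rewrite -fq f0 // ltnS ltnW.
by rewrite -fp f0.
Qed.

Lemma bary_inj (c c' : 'I_m.+1 -> R) e e' :
  \sum_j c j + e = \sum_j c' j + e' ->
  \sum_j c j *: q j + e *: p = \sum_j c' j *: q j + e' *: p ->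
  (forall j, c j = c' j) /\ e = e'.
Proof.
move=> /eqP; rewrite -subr_eq0 opprD addrACA -sumrB => /eqP s.
move=> /eqP; rewrite -subr_eq0 opprD addrACA -sumrB -scalerBl => /eqP v.
have [||h h'] := @bary_eq0 (fun j => c j - c' j) (e - e'); first by [].
  rewrite -[RHS]v; congr (_ + _); apply: eq_bigr => j _.
  by rewrite scalerBl.
by split=> [j|]; apply/eqP; rewrite -subr_eq0 ?h // h'.
Qed.

Lemma sum_delta (M : nmodType) (F : 'I_m.+1 -> M) i :
  \sum_j (if j == i then F j else 0) = F i.
Proof. by rewrite -big_mkcond big_pred1_eq. Qed.

Lemma q_inj : injective q.
Proof.
move=> i j qij; have [||h _] := @bary_inj
    (fun k => if k == i then 1 else 0) (fun k => if k == j then 1 else 0) 0 0.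
- by rewrite !sum_delta.
- have E l : \sum_k (if k == l then 1 else 0 : R) *: q k = q l.
    rewrite -[RHS](sum_delta q); apply: eq_bigr => k _.
    by case: eqP; rewrite ?scale1r ?scale0r.
  by rewrite !E qij.
move: (h i); rewrite eqxx; case: eqP => // _ /eqP.
by rewrite oner_eq0.
Qed.

Lemma q_neq_p j : q j != p.
Proof.
apply/eqP => qp; have [||_ /eqP] := @bary_inj
    (fun k => if k == j then 1 else 0) (fun=> 0) 0 1.
- by rewrite sum_delta big1 // add0r addr0.
- rewrite -qp scale1r scale0r addr0 [X in _ = X + _]big1 ?add0r.
    rewrite -[RHS](sum_delta q); apply: eq_bigr => k _.
    by case: eqP; rewrite ?scale1r ?scale0r.
  by move=> k _; rewrite scale0r.
by rewrite eq_sym oner_eq0.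
Qed.

Lemma conv_coef x : conv (pts q p) x -> exists c e,
  [/\ forall j, 0 <= c j, 0 <= e, \sum_j c j + e = 1
    & x = \sum_j c j *: q j + e *: p].
Proof.
move=> [c [c0 c1 ->]]; exists (c \o q), (c p); split.
- by move=> j; apply: c0; rewrite mem_rcons inE mem_pts' orbT.
- by apply: c0; rewrite mem_rcons inE eqxx.
- by rewrite -[RHS]c1 sum_pts.
- by rewrite sum_pts.
Qed.

(** Uniqueness of barycentric coordinates identifies these weights with those witnessing membership
    in the facet, where the omitted vertex has weight 0. *)
Lemma facet_coef (c : 'I_m.+1 -> R) e j : \sum_i c i + e = 1 ->
  facet q p j (\sum_i c i *: q i + e *: p) <->
  [/\ forall i, 0 <= c i, 0 <= e & c j = 0].
Proof.
move=> s1; split=> [[f []]|[c0 e0 cj]]; rewrite /setminus.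
  rewrite !big_filter => f0.
  rewrite !sum_pts eq_sym q_neq_p => f1 fE.
  have [||cE eE] := @bary_inj
      c (fun i => if q i != q j then f (q i) else 0) e (f p).
  - by rewrite -big_mkcond f1.
  - rewrite fE; congr (_ + _); rewrite big_mkcond /=.
    by apply: eq_bigr => i _; case: ifP; rewrite ?scale0r.
  split=> [i||].
  - rewrite cE; case: ifP => // qij; apply: f0.
    by rewrite mem_filter qij mem_rcons inE mem_pts' orbT.
  - rewrite eE; apply: f0.
    by rewrite mem_filter eq_sym q_neq_p mem_rcons inE eqxx.
  - by rewrite cE eqxx.
(* [conv] wants weights indexed by points; by injectivity of [q] the inner sum has a single term at
   each [q i]. *)
pose f z := if z == p then e else \sum_(i | q i == z) c i.
have fp : f p = e by rewrite /f eqxx.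
have fq i : f (q i) = c i.
  rewrite /f (negPf (q_neq_p i)) (big_pred1 i) // => k.
  by rewrite /= (inj_eq q_inj).
exists f; rewrite !big_filter !sum_pts eq_sym q_neq_p fp; split.
- move=> z; rewrite mem_filter mem_rcons inE => /andP[_] /orP[/eqP ->|].
    by rewrite fp.
  by move=> /codomP[i ->]; rewrite fq.
- rewrite -[RHS]s1 [in RHS](bigD1 j) //= cj add0r; congr (_ + _).
  by apply: eq_big => [i|i _]; rewrite ?(inj_eq q_inj) ?fq.
- rewrite [in LHS](bigD1 j) //= cj scale0r add0r; congr (_ + _).
  by apply: eq_big => [i|i _]; rewrite ?(inj_eq q_inj) ?fq.
Qed.

(** Differences of vertices of the facet are combinations of the edges [q i - p] with [i] other than
    [j], and [q j - p] is independent of these. This later supplies a nonzero denominator for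
    formula (A). *)
Lemma opposite_notin_SubFacet j : q j - p \notin SubFacet q p j.
Proof.
pose C (v : 'cV[R]_n) := exists2 c : 'I_m.+1 -> R,
  c j = 0 & v = \sum_i c i *: (q i - p).
apply/negP => qS.
suff [c cj qE] : C (q j - p).
  (* The difference of the two expansions of [q j - p]: the weight of [p] makes the total 0, while
     the weight of [q j] is 1. *)
  have [||h _] := @bary_eq0
      (fun i => (if i == j then 1 else 0) - c i) (\sum_i c i - 1).
  - by rewrite sumrB sum_delta addrA subrK subrr.
  - apply/eqP; move/eqP: qE; rewrite -subr_eq0 => /eqP qE; apply/eqP.
    rewrite -[RHS]qE.
    under eq_bigr do rewrite scalerBl.
    under [in RHS]eq_bigr do rewrite scalerBr.
    rewrite !sumrB -scaler_suml.
    have -> : \sum_i (if i == j then 1 else 0 : R) *: q i = q j.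
      rewrite -[RHS](sum_delta q); apply: eq_bigr => k _.
      by case: eqP; rewrite ?scale1r ?scale0r.
    rewrite scalerBl scale1r opprB addrACA [RHS]addrACA; congr (_ + _).
    exact: addrC.
  by move: (h j) => /eqP; rewrite eqxx cj subr0 oner_eq0.
have CZD a u v : C u -> C v -> C (a *: u + v).
  move=> [c cj ->] [c' c'j ->]; exists (fun i => a * c i + c' i).
    by rewrite cj c'j mulr0 addr0.
  rewrite scaler_sumr -big_split; apply: eq_bigr => i _ /=.
  by rewrite scalerDl scalerA.
have Cp z : z \in rcons (setminus (pts' q) (q j)) p -> C (z - p).
  rewrite mem_rcons inE mem_filter => /orP[/eqP ->|].
    by exists (fun=> 0) => //; rewrite subrr big1 // => i _; rewrite scale0r.
  move=> /andP[zj /codomP[i zE]]; exists (fun k => if k == i then 1 else 0).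
    by case: eqP => // ji; rewrite zE ji eqxx in zj.
  rewrite zE -[LHS](sum_delta (fun k => q k - p)); apply: eq_bigr => k _.
  by case: eqP; rewrite ?scale1r ?scale0r.
move: qS; rewrite /SubFacet /SubSp => /(@coord_span _ _ _ (in_tuple _)) ->.
apply: big_ind => [|u v Cu Cv|i _].
- by exists (fun=> 0) => //; rewrite big1 // => i _; rewrite scale0r.
- by rewrite -[u]scale1r; apply: CZD.
rewrite -[X in C X]addr0; apply: (CZD); last first.
  by exists (fun=> 0) => //; rewrite big1 // => k _; rewrite scale0r.
have /allpairsP[[y z] /= [yT zT ->]] := mem_nth 0 (ltn_ord i).
have -> : y - z = (- 1) *: (z - p) + (y - p).
  by rewrite scaleN1r opprB [RHS]addrC addrA subrK.
by apply: CZD; apply: Cp.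
Qed.

End Simplex.

(** * The line in barycentric coordinates and its first facet *)

Section Ray.
Variables (R : realType) (n m : nat).
Variables (q : 'I_m.+1 -> 'cV[R]_n) (p x d : 'cV[R]_n).
Variables (pi omega : 'I_m.+1 -> R).
Hypothesis indepS : aff_indep (pts q p).
Hypothesis omega1 : \sum_j omega j = 1.

(** [mu] is the weight of [p] in [x], and [ga] the rate at which this weight grows along [d]. The
    third clause is the nonnegativity of the other weights of [x]. *)
Definition line_coef (mu ga : R) : Prop :=
  [/\ 0 < ga, 0 <= mu, forall j, mu * omega j <= pi j
    & forall a, x + a *: d =
        \sum_j (pi j - (mu + a * ga) * omega j) *: q j + (mu + a * ga) *: p].

(** Modulo Sub(S'), the space Sub(S) is spanned by [p - p'], which gives the shape of [d]; replacing
    [p] by [p'] in the expansion of [x] gives [x']. *)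
Lemma line_coef_exists (x' p' : 'cV[R]_n)
    (xS : conv (pts q p) x)
    (dS : d \in SubSp (pts q p))
    (dS' : orth d (SubSp (pts' q)))
    (d1 : dot (p - q ord_max) d = 1)
    (projx : orth_proj (pts' q) x x')
    (projp : orth_proj (pts' q) p p')
    (pi1 : \sum_j pi j = 1) (x'E : x' = \sum_j pi j *: q j)
    (p'E : p' = \sum_j omega j *: q j) :
  exists mu ga, line_coef mu ga.
Proof.
have [c [mu [c0 mu0 c1 xE]]] := conv_coef xS.
set U := SubSp (pts' q) in dS' projx projp *.
have qU i j : q i - q j \in U by apply: mem_SubSp; apply: mem_pts'.
have p'q j : p' - q j \in U by rewrite p'E; apply: affine_comb_sub.
set e := p - p'; have eU : orth e U by case: projp.
have [ga dE] : exists ga, d = ga *: e.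
  have sub : (SubSp (pts q p) <= <[e]> + U)%VS.
    have yp' y : y \in pts q p -> y - p' \in (<[e]> + U)%VS.
      rewrite mem_rcons inE => /orP[/eqP ->|/codomP[j ->]].
        by apply: (subvP (addvSl _ _)); apply: memv_line.
      by apply: (subvP (addvSr _ _)); rewrite -opprB memvN.
    apply: SubSp_subv => y z yS zS.
    have -> : y - z = (y - p') - (z - p') by rewrite opprB addrA subrK.
    by apply: memvB; apply: yp'.
  have /memv_addP[_ /vlineP[ga ->] [u uU dE]] := subvP sub _ dS.
  exists ga; suff u0 : u = 0 by rewrite dE u0 addr0.
  apply: (orth_mem_eq0 uU).
  have -> : u = d - ga *: e by rewrite dE addrC addKr.
  by apply: orthB => //; apply: orthZ.
(* [p - q ord_max] differs from [e] by a vector of [U], which [d] annihilates, so this is the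
   normalization of [d]; it forces [ga > 0]. *)
have ga_e : ga * dot e e = 1.
  rewrite -dotZr -dE -d1.
  have -> : p - q ord_max = e + (p' - q ord_max) by rewrite addrA subrK.
  by rewrite dotDl [dot (p' - _) _]dotC dS' ?addr0.
have ga0 : 0 < ga.
  rewrite ltNge; apply/negP => ga_le0.
  have := mulr_le0_ge0 ga_le0 (dot_ge0 e).
  by rewrite ga_e ler10.
have pE : p = e + \sum_j omega j *: q j by rewrite -p'E subrK.
have sumE t : \sum_j (c j + t * omega j) = \sum_j c j + t.
  by rewrite big_split /= -mulr_sumr omega1 mulr1.
have combE t : \sum_j (c j + t * omega j) *: q j =
    \sum_j c j *: q j + t *: \sum_j omega j *: q j.
  rewrite scaler_sumr -big_split; apply: eq_bigr => j _ /=.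
  by rewrite scalerDl scalerA.
(* [y] is [x] with [p] replaced by [p']. As [x - y] is a multiple of [e], [y] is also a projection
   of [x], so it equals [x'], and coordinates can be compared. *)
have piE j : pi j = c j + mu * omega j.
  pose y := \sum_j (c j + mu * omega j) *: q j.
  have xy : x - y = mu *: e.
    rewrite xE /y combE opprD addrACA subrr add0r -scalerBr.
    by rewrite pE addrK.
  have yx'0 : y - x' = 0.
    apply: (@orth_mem_eq0 _ _ _ U).
      have -> : y - x' = (y - q ord0) - (x' - q ord0).
        by rewrite opprB addrA subrK.
      apply: memvB; last by rewrite x'E; apply: affine_comb_sub.
      by apply: affine_comb_sub => //; rewrite sumE.
    have -> : y - x' = (x - x') - (x - y).
      by rewrite opprB [RHS]addrC addrA subrK.
    by apply: orthB; [case: projx | rewrite xy; apply: orthZ].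
  have [||-> //] := @bary_inj _ _ _ _ _ indepS pi
      (fun j => c j + mu * omega j) 0 0.
    by rewrite sumE pi1 addr0 addr0 -c1.
  by rewrite -x'E -/y; congr (_ + _); apply/esym/eqP; rewrite -subr_eq0 yx'0.
exists mu, ga; split=> // [j|a]; first by rewrite piE lerDr.
have -> : \sum_j (pi j - (mu + a * ga) * omega j) *: q j =
    \sum_j (c j + (- (a * ga)) * omega j) *: q j.
  by apply: eq_bigr => j _; rewrite piE; congr (_ *: _); ring.
rewrite combE xE dE scalerA scalerDl -p'E /e scalerBr scaleNr -!addrA.
by congr (_ + _); rewrite [RHS]addrCA; congr (_ + _); rewrite addrC.
Qed.

Variables (mu ga : R).
Hypothesis lineE : line_coef mu ga.
Hypothesis pi1 : \sum_j pi j = 1.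
Local Notation t a := (mu + a * ga).

Let ga0 : 0 < ga. Proof. by case: lineE. Qed.

Lemma hitsE j a : hits q p x d j a <->
  [/\ 0 <= t a, forall i, t a * omega i <= pi i & pi j = t a * omega j].
Proof.
case: lineE => _ _ _ xaE; rewrite /hits /mkset xaE facet_coef //; last first.
  by rewrite sumrB -mulr_sumr pi1 omega1 mulr1 subrK.
split=> [[c0 t0 /eqP]|[t0 c0 ->]]; rewrite ?subrr.
  by rewrite subr_eq0 => /eqP cj; split=> // i; rewrite -subr_ge0.
by split=> // i; rewrite subr_ge0.
Qed.

(** [v] annihilates every [q i - p] with [i] other than [j], so pairing with [v] sees only the
    [j]-th barycentric coordinate. *)
Lemma dot_SubFacet_orth j v : orth v (SubFacet q p j) ->
  dot d v = ga * omega j * dot (p - q j) v /\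
  dot (p - x) v = (pi j - mu * omega j) * dot (p - q j) v.
Proof.
case: lineE => _ _ _ xaE vU.
have vp : forall i, dot (q i - p) v = if i == j then dot (q j - p) v else 0.
  move=> i; case: eqVneq => [-> //|ij]; rewrite dotC vU //.
  apply: mem_SubSp; rewrite mem_rcons inE ?eqxx // mem_filter mem_pts'.
  by rewrite (inj_eq (q_inj indepS)) ij orbT.
have comb (c : 'I_m.+1 -> R) :
    dot (\sum_i c i *: (q i - p)) v = c j * dot (q j - p) v.
  rewrite dot_suml; under eq_bigr do rewrite dotZl vp.
  rewrite (bigD1 j) //= eqxx big1 ?addr0 // => i /negPf ->.
  by rewrite mulr0.
have xaE' a : x + a *: d =
    p + \sum_i (pi i - t a * omega i) *: (q i - p).
  rewrite xaE; under [in RHS]eq_bigr do rewrite scalerBr.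
  rewrite sumrB -scaler_suml.
  rewrite [in RHS]sumrB -mulr_sumr pi1 omega1 mulr1.
  by rewrite addrCA scalerBl scale1r opprB [p + _]addrC subrK.
have xE a : dot (p - (x + a *: d)) v =
    (pi j - t a * omega j) * dot (p - q j) v.
  rewrite xaE' opprD addrA subrr sub0r -scaleN1r dotZl comb.
  by rewrite !dotBl; ring.
have := xE 0; rewrite scale0r mul0r !addr0 => x0E; split=> //.
(* [d] is the increment of the line between parameters 0 and 1. *)
have -> : dot d v = dot (p - x) v - dot (p - (x + 1 *: d)) v.
  rewrite scale1r opprD addrA [dot (p - x - d) _]dotBl opprB addrCA subrr.
  by rewrite addr0.
by rewrite xE x0E; ring.
Qed.

Variable w : 'I_m.+1 -> (n - m).-tuple 'cV[R]_n.
Hypothesis wB : forall j, orthocompl_basis (SubFacet q p j) (w j).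

Let w_orth j i : orth (tnth (w j) i) (SubFacet q p j).
Proof.
case: (wB j) => _ wE; apply: (wE _).1.
by apply: memv_span; apply: mem_tnth.
Qed.

(** The factor [dot (p - q j) v] cancels in the quotient, so whichever basis vector is used, the
    value is where the [j]-th coordinate vanishes. *)
Lemma formulaA_hit j a : formulaA p x d w j a ->
  omega j != 0 /\ pi j = t a * omega j.
Proof.
move=> [i]; have [-> ->] := dot_SubFacet_orth (@w_orth j i).
set D := dot _ _; rewrite !mulf_eq0 !negb_or -andbA => /and3P[gaN0 oN0 DN0] ->.
by split=> //; field; rewrite gaN0 oN0 DN0.
Qed.

(** If all basis vectors were orthogonal to [p - q j], so would be the residual of [q j - p] modulo
    [SubFacet]; but that product is minus the squared norm of the residual, which would put
    [q j - p] in [SubFacet]. *)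
Lemma formulaA_exists j : omega j != 0 -> exists a, formulaA p x d w j a.
Proof.
move=> oN0.
suff [i iN0] : exists i, dot (p - q j) (tnth (w j) i) != 0.
  exists (dot (p - x) (tnth (w j) i) / dot d (tnth (w j) i)); exists i => //.
  have [-> _] := dot_SubFacet_orth (@w_orth j i).
  by rewrite !mulf_neq0 // gt_eqF.
apply/existsP; apply: contraT; rewrite negb_exists => /forallP w0.
have [u uU rU] : exists2 u, u \in SubFacet q p j &
    orth (q j - p - u) (SubFacet q p j) by apply: orth_residual.
have : q j - p - u \in <<w j>>%VS by case: (wB j) => _ wE; apply: (wE _).2.
move=> /(@dot_span_eq0 _ _ (p - q j)) pr0.
have {pr0} : dot (p - q j) (q j - p - u) = 0.
  by apply: pr0 => z /tnthP[i ->]; apply/eqP; move: (w0 i); rewrite negbK.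
rewrite -opprB -[in X in dot X](subrK u (q j - p)) -scaleN1r dotZl dotDl.
rewrite [dot u _]dotC rU // addr0 mulN1r => /eqP; rewrite oppr_eq0.
move=> /eqP /dot_eq0 /eqP; rewrite subr_eq0 => /eqP qu.
by have := opposite_notin_SubFacet indepS j; rewrite qu uU.
Qed.

Lemma is_alpha_hits j a : is_alpha q p x d j a -> hits q p x d j a.
Proof. by case=> [->|[_ [[]]]]. Qed.

(** The [j]-th coordinate varies at the nonzero rate [- ga * omega j], so the line meets this facet
    only once. *)
Lemma hits_is_alpha j a : omega j != 0 -> hits q p x d j a ->
  is_alpha q p x d j a.
Proof.
move=> oN0 ja; left; apply/seteqP; split=> b /=; last by move->.
move=> /hitsE[_ _ jb]; move: ja => /hitsE[_ _ ja].
have /(mulIf oN0) /addrI : t b * omega j = t a * omega j by rewrite -jb.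
by move=> /(mulIf (lt0r_neq0 ga0)).
Qed.

(** Every value of [is_alpha] is a hit, so minimality among nonnegative hits suffices. *)
Lemma first_hit k a : is_alpha q p x d k a -> 0 <= a ->
  (forall j b, hits q p x d j b -> 0 <= b -> a <= b) ->
  [/\ first_intersected q p x d k, is_alphaf q p x d a
    & is_alpha q p x d k a].
Proof.
move=> ka a0 amin.
have fa : is_alphaf q p x d a.
  split; first by split=> //; exists k.
  by move=> b [b0 [j /is_alpha_hits jb]]; apply: amin jb b0.
by split=> //; exists a => //; apply: is_alpha_hits.
Qed.

Lemma degenerate_facet k : pi k = 0 -> omega k = 0 ->
  [/\ first_intersected q p x d k, is_alphaf q p x d 0
    & is_alpha q p x d k 0].
Proof.
move=> pk ok; have k0 : hits q p x d k 0.
  by case: lineE => _ mu0 c0 _; apply/hitsE; rewrite mul0r addr0 pk ok mulr0.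
apply: first_hit => //.
(* A second hit besides 0 selects the clause of [is_alpha] on several hits; otherwise 0 is the only
   hit. *)
have [[b [kb b0]]|none] := pselect (exists b, hits q p x d k b /\ b <> 0).
  by right; split; [exists b, 0 | split=> // c []].
left; apply/seteqP; split=> b /=; last by move->.
by move=> kb; apply: contrapT => b0; apply: none; exists b.
Qed.

Lemma case2_data_exists : exists k1 a1 k2 a2,
  case2_data p x d pi omega w k1 a1 k2 a2.
Proof.
case: lineE => _ mu0 c0 _.
(* The [omega j] sum to 1, so one is positive, and there [pi j] is at least [mu * omega j]. *)
have [j0 /andP[pj0 oj0]] : exists j, (0 <= pi j) && (0 < omega j).
  apply/existsP; apply: contraT; rewrite negb_exists => /forallP none.
  have : \sum_j omega j <= 0.
    apply: sumr_le0 => j _; rewrite leNgt; apply/negP => oj.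
    have := none j; rewrite oj andbT => /negP; apply.
    by apply: le_trans (c0 j); rewrite mulr_ge0 // ltW.
  by rewrite omega1 ler10.
pose P1 j := (0 <= pi j) && (0 < omega j).
have [k1 /andP[pk1 ok1] k1min] := @arg_minP _ _ _ j0 P1
  (fun j => pi j / omega j) (introT andP (conj pj0 oj0)).
have [a1 Aa1] := formulaA_exists (lt0r_neq0 ok1).
have k1P : is_k1 pi omega k1.
  by split=> // j pj oj; apply: k1min; rewrite /P1 pj oj.
have [[i [pi_i oi]]|J0] := pselect (exists j, inJ pi omega j); last first.
  (* With [J] empty, [k1] also serves as the dummy second index. *)
  by exists k1, a1, k1, -oo%E; split.
pose P2 j := (pi j <= 0) && (omega j < 0).
have [k2 /andP[pk2 ok2] k2max] := @arg_maxP _ _ _ i P2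
  (fun j => pi j / omega j) (introT andP (conj pi_i oi)).
have [r Ar] := formulaA_exists (ltr0_neq0 ok2).
exists k1, a1, k2, r%:E; split=> // [_|]; last by case; exists i.
split; last by exists r.
by split=> // j [pj oj]; apply: k2max; rewrite /P2 pj oj.
Qed.

Lemma first_facet k1 a1 k2 a2 :
  ~ (exists k, pi k = 0 /\ omega k = 0) ->
  case2_data p x d pi omega w k1 a1 k2 a2 ->
  (exists k a, argmin_ge0 [:: (k1, a1%:E); (k2, a2)] k a%:E) /\
  (forall k a, argmin_ge0 [:: (k1, a1%:E); (k2, a2)] k a%:E ->
     [/\ first_intersected q p x d k, is_alphaf q p x d a
       & is_alpha q p x d k a]).
Proof.
case: lineE => _ mu0 c0 _ nondeg [[pk1 ok1 k1min] A1 J1 J0].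
have [o1N0 p1E] := formulaA_hit A1.
(* [t a1] is the ratio at [k1], the least of the upper bounds on [t]. *)
have tmaxP i s : 0 < omega i -> s <= t a1 -> s * omega i <= pi i.
  move=> oi sa; apply: le_trans (ler_wpM2r (ltW oi) sa) _.
  have pi0 : 0 <= pi i by apply: le_trans (c0 i); rewrite mulr_ge0 // ltW.
  by have := k1min _ pi0 oi; rewrite p1E mulfK // ler_pdivlMr.
have a1_ge0 : 0 <= a1.
  have := c0 k1; rewrite p1E ler_pM2r // lerDl.
  by rewrite pmulr_lge0.
have tle a b : a <= b -> t a <= t b by move=> ab; rewrite lerD2l ler_pM2r.
(* Beyond [mu], only the constraints with [omega i > 0] can become violated: the others hold at [mu]
   and do not tighten as [t] grows. *)
have hits0 a : 0 <= a -> a <= a1 -> forall i, t a * omega i <= pi i.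
  move=> a0 aa1 i; have [oi|oi|oi] := ltgtP 0 (omega i).
  - by apply: tmaxP; rewrite ?tle.
  - apply: le_trans (c0 i); rewrite ler_nM2r // lerDl.
    by rewrite mulr_ge0 // ltW.
  - by have := c0 i; rewrite -oi !mulr0.
have t0 a : 0 <= a -> 0 <= t a.
  by move=> a0; rewrite addr_ge0 // mulr_ge0 // ltW.
(* The constraint of [k2] is a lower bound on [t], attained at [t r] and satisfied by [mu]. *)
have k2_le0 r : is_k2 pi omega k2 -> formulaA p x d w k2 r -> r <= 0.
  move=> [[_ o2] _] /formulaA_hit[_ p2E].
  by have := c0 k2; rewrite p2E ler_nM2r // gerDl pmulr_lle0.
have a2P : (0 <= a2)%E -> [/\ a2 = 0%E, is_k2 pi omega k2
    & formulaA p x d w k2 0].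
  have [J|nJ] := pselect (exists j, inJ pi omega j); last by rewrite J0.
  have [k2P [r Ar ->]] := J1 J; rewrite lee_fin => r0.
  have r0E : r = 0 by apply/eqP; rewrite eq_le r0 k2_le0.
  by rewrite r0E in Ar *.
have hit1 : is_alpha q p x d k1 a1.
  apply: hits_is_alpha => //; apply/hitsE.
  by split; rewrite ?t0 //; apply: hits0.
split.
  have [a20|a2N] := boolP (0 <= a2)%E.
    have [a2E _ _] := a2P a20; exists k2, 0; split=> //.
      by rewrite !inE a2E eqxx orbT.
  exists k1, a1; split; rewrite ?inE ?eqxx ?lee_fin // => k' a'.
  rewrite !inE => /orP[/eqP[_ -> //]|/eqP[_ ->] a2p].
  by rewrite a2p in a2N.
move=> k a [kin]; rewrite lee_fin => a0 amin.
(* At 0 minimality is immediate and only a hit is needed, from either candidate. A positive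
   minimizer must come from [k1], since a nonnegative [a2] is 0. *)
have [a_zero|a_pos] := eqVneq a 0.
  rewrite a_zero in kin *; apply: first_hit => //.
  move: kin; rewrite !inE => /orP[/eqP[-> ->] //|/eqP[-> a2E]].
  have [_ [[_ o2] _] A2] := a2P (eq_ind _ (fun z => 0 <= z)%E (lexx 0%E) _ a2E).
  have [o2N0 p2E] := formulaA_hit A2.
  apply: hits_is_alpha => //; apply/hitsE.
  by split; rewrite ?t0 //; apply: hits0.
have [kE aE] : k = k1 /\ a = a1.
  move: kin; rewrite !inE => /orP[/eqP[-> ->] //|/eqP[_ a2E]].
  have [|a20 _ _] := a2P; first by rewrite -a2E lee_fin.
  by move: a_pos; rewrite -eqe a2E a20 eqxx.
rewrite kE aE in a_pos amin *; apply: first_hit => // j b.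
move=> /hitsE[tb0 cb jb] b0.
have tab s u : t s <= t u -> s <= u by rewrite lerD2l ler_pM2r.
have [oj|oj|oj] := ltgtP 0 (omega j).
(* Here [t b] is one of the ratios minimized by [k1]. *)
- have pj0 : 0 <= pi j by rewrite jb mulr_ge0 // ltW.
  by apply: tab; have := k1min _ pj0 oj; rewrite p1E jb !mulfK // lt0r_neq0.
(* Maximality of the ratio at [k2] gives [b <= r], so [r] is nonnegative and competes in the argmin:
   [a1 <= r <= 0 <= b]. *)
- have jJ : inJ pi omega j by split; rewrite // jb mulr_ge0_le0 // ltW.
  have [k2P [r Ar a2E]] := J1 (ex_intro _ j jJ).
  have [o2N0 p2E] := formulaA_hit Ar.
  have br : b <= r.
    by apply: tab; have := k2P.2 j jJ; rewrite p2E jb !mulfK // ltr0_neq0.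
  apply: le_trans (b0); apply: le_trans (k2_le0 r k2P Ar).
  rewrite -lee_fin -a2E; apply: (amin k2); first by rewrite !inE eqxx orbT.
  by rewrite a2E lee_fin (le_trans b0).
(* With [omega j = 0] a hit forces [pi j = 0], the excluded degenerate case. *)
- by case: nondeg; exists j; rewrite jb -oj mulr0.
Qed.

End Ray.

Theorem theorem1 (R : realType) (n m : nat)
    (q : 'I_m.+1 -> 'cV[R]_n) (p x d x' p' : 'cV[R]_n)
    (pi omega : 'I_m.+1 -> R)
    (indepS : aff_indep (pts q p))
    (xS : conv (pts q p) x)
    (dS : d \in SubSp (pts q p))
    (dS' : orth d (SubSp (pts' q)))
    (d1 : dot (p - q ord_max) d = 1)
    (center : exists c : 'cV[R]_n,
       [/\ aff (pts q p) c,
           forall y z, y \in pts q p -> z \in pts q p -> enorm (c - y) = enorm (c - z) &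
           exists a : R, c = x + a *: d])
    (projx : orth_proj (pts' q) x x')
    (projp : orth_proj (pts' q) p p')
    (pi1 : \sum_j pi j = 1) (x'E : x' = \sum_j pi j *: q j)
    (omega1 : \sum_j omega j = 1) (p'E : p' = \sum_j omega j *: q j) :
  (forall k, pi k = 0 -> omega k = 0 ->
     [/\ first_intersected q p x d k, is_alphaf q p x d 0
       & is_alpha q p x d k 0])
  /\
  (~ (exists k, pi k = 0 /\ omega k = 0) ->
   forall w : 'I_m.+1 -> (n - m).-tuple 'cV[R]_n,
   (forall j, orthocompl_basis (SubFacet q p j) (w j)) ->
   (exists k1 a1 k2 a2, case2_data p x d pi omega w k1 a1 k2 a2)
   /\
   (forall k1 a1 k2 a2, case2_data p x d pi omega w k1 a1 k2 a2 ->
      (exists k a, argmin_ge0 [:: (k1, a1%:E); (k2, a2)] k a%:E) /\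
      (forall k a, argmin_ge0 [:: (k1, a1%:E); (k2, a2)] k a%:E ->
         [/\ first_intersected q p x d k, is_alphaf q p x d a
           & is_alpha q p x d k a]))).
Proof.
have [mu [ga lineE]] :=
  line_coef_exists indepS omega1 xS dS dS' d1 projx projp pi1 x'E p'E.
split=> [k pk ok|nondeg w wB]; first exact: (degenerate_facet _ _ lineE).
split; first exact: (case2_data_exists _ _ lineE).
by move=> k1 a1 k2 a2; apply: (first_facet _ _ lineE).
Qed.
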